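(* Let $A$ be a set and let $\Gamma$ be a finite set of unary relations on $A$ (i.e. a finite set of subsets of $A$) containing some $\gamma\in\Gamma$ with $\emptyset\neq\gamma\subsetneq A$. Then $$\bigl|\{\operatorname{Pol}_A Q \mid Q\subseteq \mathrm{DD}(\Gamma),\ Q \text{ finite}\}\bigr| = \bigl|\{\operatorname{Pol}_A Q \mid Q\subseteq \mathrm{DD}(\Gamma)\}\bigr| = \aleph_0 .$$
   Context: An $n$-ary relation on $A$ is a subset of $A^n$; an $n$-ary operation on $A$ is a map $A^n\to A$. Let $\mathrm{O}_A$ be the set of all operations on $A$ of arity $n\geq 1$. An $n$-ary operation $f$ preserves an $m$-ary relation $\rho\subseteq A^m$ (written $f\rhd\rho$) if for all $r_1,\dots,r_n\in\rho$ the $m$-tuple obtained by applying $f$ coordinatewise to $r_1,\dots,r_n$ is in $\rho$. For a set $Q$ of finitary relations on $A$ (of positive arity), $\operatorname{Pol}_A Q=\{f\in \mathrm{O}_A\mid f\rhd\rho \text{ for all }\rho\in Q\}$. For $n\geq 1$ and $\gamma_1,\dots,\gamma_n\subseteq A$ put $\mathrm{R}(\gamma_1,\dots,\gamma_n)=\{(x_1,\dots,x_n)\in A^n\mid x_1\in\gamma_1\text{ or }\dots\text{ or }x_n\in\gamma_n\}$. For a set $\Gamma$ of unary relations on $A$, $\mathrm{DD}(\Gamma)$ is the set of all relations $\mathrm{R}(\gamma_1,\dots,\gamma_n)$ with $n\geq 1$ and $(\gamma_1,\dots,\gamma_n)\in\Gamma^n$. *)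

(* Defs.v *)
From mathcomp Require Import all_boot.
From mathcomp Require Import classical_sets functions cardinality.

Set Implicit Arguments.
Unset Strict Implicit.
Unset Printing Implicit Defensive.

Local Open Scope classical_set_scope.

(* An element of [A ^ n] is a function ['I_n -> A]. The two types below also
   contain the nullary operations and relations; the arity is constrained to be
   positive where the sets [operations], [Pol] and [DD] are formed. *)
Definition finitary_op (A : Type) := {n : nat & ('I_n -> A) -> A}.

Definition finitary_rel (A : Type) := {m : nat & set ('I_m -> A)}.

Definition operations (A : Type) : set (finitary_op A) :=
  [set f | (1 <= tag f)%N].

Definition preserves (A : Type) (f : finitary_op A) (rho : finitary_rel A) : Prop :=
  forall r : 'I_(tag f) -> ('I_(tag rho) -> A),
    (forall i, tagged rho (r i)) ->
    tagged rho (fun j => tagged f (fun i => r i j)).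

Definition Pol (A : Type) (Q : set (finitary_rel A)) : set (finitary_op A) :=
  [set f | operations f /\ forall rho, Q rho -> preserves f rho].

Definition disj_rel (A : Type) (n : nat) (gamma : 'I_n -> set A) :
    set ('I_n -> A) :=
  [set x | exists i, gamma i (x i)].

Definition DD (A : Type) (Gamma : set (set A)) : set (finitary_rel A) :=
  [set rho | exists (n : nat) (gamma : 'I_n -> set A),
    [/\ (1 <= n)%N, forall i, Gamma (gamma i) &
        rho = existT (fun m => set ('I_m -> A)) n (disj_rel gamma)]].

(* Main.v *)
(* Writing [Gamma] as [g 0, .., g (k-1)], a relation of [DD Gamma] is given by a
   word over ['I_k], and which operations preserve it depends only on the numbers
   of occurrences of the letters.  Repeating a letter which already occurs can
   only shrink the set of operations preserving the relation, so for every [Q]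
   the words whose relation is not preserved by [Pol Q] form an up-set for a well
   quasi-order (Dickson).  Such an up-set has a finite basis, and [Pol Q] is
   determined by it; hence there are only countably many [Pol Q].

   Conversely, for [a] in [gamma] and [b] outside, the [m]-ary operation with
   value [b] on the tuples with at most one entry in [gamma], and [a] on the
   others, preserves [R(gamma, .., gamma)] with [n] entries iff [n < m], so these
   relations have pairwise distinct clones. *)
Require Import Defs.
From mathcomp Require Import all_boot.
From mathcomp Require Import boolp classical_sets functions cardinality.

Set Implicit Arguments.
Unset Strict Implicit.
Unset Printing Implicit Defensive.

Local Open Scope classical_set_scope.
Local Open Scope card_scope.

(** Induction on [fs]: take a basis [F0] for the remaining functions. A point where [f] is at least
    its maximum over [F0] lies above a member of [F0]; the other points fall into finitely many
    slices on which [f] is constant, each with its own basis by induction. *)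
Lemma dickson_basis (X : eqType) (fs : seq (X -> nat)) (U : set X) :
  exists F : seq X, (forall y, y \in F -> U y) /\
    (forall x, U x -> exists2 y, y \in F & all (fun f => f y <= f x) fs).
Proof.
elim: fs U => [|f fs IH] U.
  have [[x Ux]|U0] := pselect (exists x, U x).
    exists [:: x]; split=> [y|y _]; first by rewrite inE => /eqP ->.
    by exists x; rewrite ?inE.
  by exists [::]; split=> // x Ux; case: U0; exists x.
have [F0 [F0U F0P]] := IH U.
have below N : exists F : seq X, (forall y, y \in F -> U y) /\
    (forall x, U x -> f x < N ->
       exists2 y, y \in F & all (fun f => f y <= f x) (f :: fs)).
  elim: N => [|N [F [FU FP]]]; first by exists [::].
  have [G [GU GP]] := IH [set x | U x /\ f x = N].
  exists (F ++ G); split=> [y|x Ux].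
    by rewrite mem_cat => /orP[/FU|/GU[]].
  rewrite ltnS leq_eqVlt => /orP[/eqP fx|/(FP x Ux)[y yF fy]].
    have [y yG fy] := GP x (conj Ux fx).
    exists y; first by rewrite mem_cat yG orbT.
    by rewrite /= fy (GU _ yG).2 fx leqnn.
  by exists y => //; rewrite mem_cat yF.
have [F [FU FP]] := below (\max_(y <- F0) f y).
exists (F0 ++ F); split=> [y|x Ux]; first by rewrite mem_cat => /orP[/F0U|/FU].
have [/(FP x Ux)[y yF fy]|ge_fx] := ltnP (f x) (\max_(y <- F0) f y).
  by exists y => //; rewrite mem_cat yF orbT.
have [y yF0 fy] := F0P x Ux.
exists y; first by rewrite mem_cat yF0.
by rewrite /= fy andbT; apply: leq_trans ge_fx; apply: leq_bigmax_seq.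
Qed.

Lemma fiberwise_surjection (C : eqType) (I J : finType) (u : I -> C) (v : J -> C) :
    (forall c, #|[pred i | u i == c]| <= #|[pred j | v j == c]|) ->
    (forall c, #|[pred i | u i == c]| = 0 -> #|[pred j | v j == c]| = 0) ->
  exists h : J -> I, (forall j, u (h j) = v j) /\ (forall i, exists j, h j = i).
Proof.
move=> le_card supp.
have /choice[d ud] j : exists i, u i = v j.
  have [/existsP[i /eqP]|] := boolP [exists i, u i == v j]; first by exists i.
  rewrite negb_exists => /forallP none.
  have /supp/card0_eq/(_ j) : #|[pred i | u i == v j]| = 0.
    by apply: eq_card0 => i; rewrite !inE (negbTE (none i)).
  by rewrite inE eqxx.
(* Within each colour, equal positions in the two enumerated fibres are matched; surplus positions
   fall back on [d j], which has the right colour. *)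
pose h j := nth (d j) (enum [pred i | u i == v j])
                (index j (enum [pred j' | v j' == v j])).
exists h; split=> [j|i].
  rewrite /h; set s := enum _; set t := enum _.
  have [lt_ts|ge_ts] := ltnP (index j t) (size s).
    by have := mem_nth (d j) lt_ts; rewrite mem_enum inE => /eqP.
  by rewrite nth_default.
set s := enum [pred i' | u i' == u i].
set t := enum [pred j | v j == u i].
have is_ : i \in s by rewrite mem_enum inE.
have lt_it : index i s < size t.
  by rewrite (leq_trans _ (_ : size s <= _)) ?index_mem // -!cardE le_card.
have j0 : J by case: t lt_it.
have vj : v (nth j0 t (index i s)) = u i.
  by have := mem_nth j0 lt_it; rewrite mem_enum inE => /eqP.
exists (nth j0 t (index i s)).
by rewrite /h vj index_uniq ?enum_uniq // nth_index.
Qed.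

Section DisjunctiveRelations.
Variable A : Type.
Implicit Types (f : finitary_op A) (Q : set (finitary_rel A)).

Lemma Pol_subset Q Q' : Q `<=` Q' -> Pol Q' `<=` Pol Q.
Proof. by move=> QQ' f [f_op fQ']; split=> // rho /QQ'/fQ'. Qed.

Definition disj n (gamma : 'I_n -> set A) : finitary_rel A :=
  existT (fun m => set ('I_m -> A)) n (disj_rel gamma).

(** Tuples of the relation on ['I_n] pull back along [h]; surjectivity keeps the pulled-back tuples
    in the relation on ['I_m]. *)
Lemma preserves_disj_reindex f m n (gamma : 'I_n -> set A) (h : 'I_m -> 'I_n) :
    (forall i, exists j, h j = i) ->
  preserves f (disj (gamma \o h)) -> preserves f (disj gamma).
Proof.
move=> h_surj pres r rP.
have [i|j fj] := pres (fun i j => r i (h j)); last by exists (h j).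
by have [c rc] := rP i; have [j hj] := h_surj c; exists j; rewrite /= hj.
Qed.

Section Words.
Variables (k : nat) (g : 'I_k -> set A).

Definition word := {n : nat & {ffun 'I_n -> 'I_k}}.

Definition word_rel (w : word) : finitary_rel A := disj (g \o tagged w).

Definition occ (c : 'I_k) (w : word) : nat := #|[pred i | tagged w i == c]|.

(* Comparing also the indicators of [occ c w = 0] forces two comparable words to
   have the same letters. *)
Definition word_stats : seq (word -> nat) :=
  [seq occ c | c <- enum 'I_k] ++ [seq (fun w => occ c w == 0 : nat) | c <- enum 'I_k].

Definition word_le (v w : word) := all (fun s => s v <= s w) word_stats.

Lemma preserves_word_le f (v w : word) : word_le v w ->
  preserves f (word_rel w) -> preserves f (word_rel v).
Proof.
rewrite /word_le all_cat all_map [X in _ && X]all_map => /andP[/allP le_occ /allP le_supp].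
have [c|c vc|h [vh h_surj]] :=
    @fiberwise_surjection _ _ _ (tagged v) (tagged w).
- by apply: (le_occ c); rewrite mem_enum.
- have := le_supp c; rewrite mem_enum /= /occ vc eqxx => /(_ isT).
  by case: eqP.
rewrite /word_rel => pres; apply: (preserves_disj_reindex h_surj).
suff -> : (g \o tagged v) \o h = g \o tagged w by [].
by apply/funext => j /=; rewrite vh.
Qed.

(** The finite list [F] of forbidden words serves as a countable code for a clone. *)
Definition avoiding_rels (F : seq word) : set (finitary_rel A) :=
  [set word_rel w | w in [set w | forall v, v \in F -> ~ word_le v w]].

Lemma Pol_avoiding Q : Q `<=` range word_rel ->
  exists F, Pol Q = Pol (avoiding_rels F).
Proof.
move=> Qw.
pose bad : set word := [set w | ~ Pol Q `<=` [set f | preserves f (word_rel w)]].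
have [F [Fbad Fbasis]] := dickson_basis word_stats bad.
exists F; apply/seteqP; split=> [f fQ|].
  split; first by case: fQ.
  move=> _ [w wF <-].
  have [|Nsub] := pselect (Pol Q `<=` [set f | preserves f (word_rel w)]).
    exact.
  by have [v /wF] := Fbasis w Nsub.
(* A word of [Q] above some [v] in [F] would force [Pol Q] to preserve the relation of [v], although
   [v] is bad. *)
apply: Pol_subset => rho Qrho; have [w _ w_rho] := Qw _ Qrho.
exists w => // v /Fbad bad_v le_vw; apply: bad_v => f [_ fQ].
by apply: (preserves_word_le le_vw); rewrite w_rho; apply: fQ.
Qed.

End Words.

Lemma DD_words (Gamma : set (set A)) : finite_set Gamma ->
  exists (k : nat) (g : 'I_k -> set A), DD Gamma `<=` range (word_rel g).
Proof.
move=> /finite_seqP[s Gamma_s].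
exists (size s), (tnth (in_tuple s)) => _ [n [gamma [_ Ggamma ->]]].
have /choice[w wP] i : exists c, tnth (in_tuple s) c = gamma i.
  have /tnthP[c ->] : gamma i \in in_tuple s by have := Ggamma i; rewrite Gamma_s.
  by exists c.
exists (existT _ n (finfun w)) => //.
rewrite /word_rel /=; suff -> : tnth (in_tuple s) \o finfun w = gamma by [].
by apply/funext => i /=; rewrite ffunE.
Qed.

Lemma countable_Pol_DD (Gamma : set (set A)) : finite_set Gamma ->
  countable [set Pol Q | Q in [set Q | Q `<=` DD Gamma]].
Proof.
move=> /DD_words[k [g DDg]].
apply: (@sub_countable _ _ _ [set: seq (word k)]); last exact: countableP.
apply: (card_le_trans _ (card_image_le (@Pol A \o avoiding_rels g) setT)).
apply: subset_card_le => _ [Q QDD <-].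
have [F QF] := Pol_avoiding (subset_trans QDD DDg).
by exists F.
Qed.

Section Threshold.
Variables (gamma : set A) (a b : A).
Hypotheses (gamma_a : gamma a) (gammaNb : ~ gamma b).

Definition threshold_op m : finitary_op A :=
  existT (fun n => ('I_n -> A) -> A) m
    (fun x => if #|[pred i | `[< gamma (x i) >]]| <= 1 then b else a).

Definition power_rel n := disj (fun _ : 'I_n => gamma).

(** Pigeonhole: choose in each of the [m] rows a column with entry in [gamma]. If the result avoids
    [gamma], no column is chosen twice, which is impossible for [n < m]. *)
Lemma threshold_preserves m n : n < m -> preserves (threshold_op m) (power_rel n).
Proof.
move=> lt_nm r /= /choice[c rc]; apply: contrapT => no_gamma.
have c_inj : injective c.
  move=> i i' cii'; apply: contrapT => ii'; apply: no_gamma.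
  exists (c i); case: leqP => // /card_le1_eqP/(_ i' i) eq_ii'; exfalso.
  by apply/ii'/eq_ii'; rewrite inE // cii'.
by have := leq_card c c_inj; rewrite !card_ord leqNgt lt_nm.
Qed.

Lemma threshold_Npreserves n : ~ preserves (threshold_op n) (power_rel n).
Proof.
(* With [a] on the diagonal and [b] elsewhere, every column has just one entry in [gamma], so the
   result is constantly [b]. *)
move=> /(_ (fun i j => if i == j then a else b)) [i|j] /=.
  by exists i; rewrite eqxx.
case: leqP => // + _; rewrite ltnNge => /negP; apply; apply/card_le1_eqP => i i'.
by rewrite !inE; case: eqP => [->|//]; case: eqP.
Qed.

(** For [n < m], [threshold_op m.+1] separates the two clones; the successors keep arities
    positive. *)
Lemma Pol_power_rel_inj : injective (fun n => Pol [set power_rel n.+1]).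
Proof.
have Pol_neq n m : n < m -> Pol [set power_rel n.+1] <> Pol [set power_rel m.+1].
  move=> lt_nm eqPol.
  have : Pol [set power_rel n.+1] (threshold_op m.+1).
    by split=> // _ ->; apply: threshold_preserves.
  by rewrite eqPol => -[_ /(_ _ erefl)/threshold_Npreserves].
by move=> n m eqPol; case: (ltngtP n m) => // /Pol_neq; rewrite eqPol.
Qed.

Lemma infinite_Pol_DD (Gamma : set (set A)) : Gamma gamma ->
  [set: nat] #<= [set Pol Q | Q in [set Q | Q `<=` DD Gamma /\ finite_set Q]].
Proof.
move=> Ggamma.
have inj : {in [set: nat] &, injective (fun n => Pol [set power_rel n.+1])}.
  by move=> n m _ _; apply: Pol_power_rel_inj.
rewrite -(card_le_eql (inj_card_eq inj)).
apply: subset_card_le => _ [n _ <-]; exists [set power_rel n.+1] => //.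
split; last exact: finite_set1.
by move=> _ ->; exists n.+1, (fun=> gamma).
Qed.

End Threshold.
End DisjunctiveRelations.

Theorem corollary23 (A : Type) (Gamma : set (set A))
    (Gamma_fin : finite_set Gamma)
    (Gamma_nontriv :
      exists gamma : set A, [/\ Gamma gamma, gamma <> set0 & gamma `<` setT]) :
  ([set Pol Q | Q in [set Q | Q `<=` DD Gamma /\ finite_set Q]]
     #= [set Pol Q | Q in [set Q | Q `<=` DD Gamma]]) /\
  ([set Pol Q | Q in [set Q | Q `<=` DD Gamma]] #= [set: nat]).
Proof.
have [gamma [Ggamma /eqP/set0P[a gamma_a] [_ gammaNT]]] := Gamma_nontriv.
have [b gammaNb] : exists b, ~ gamma b.
  by apply/existsNP => all_gamma; apply: gammaNT => x _.
have infinite := infinite_Pol_DD gamma_a gammaNb Ggamma.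
have countable := countable_Pol_DD Gamma_fin.
have sub : [set Pol Q | Q in [set Q | Q `<=` DD Gamma /\ finite_set Q]]
    `<=` [set Pol Q | Q in [set Q | Q `<=` DD Gamma]].
  by apply: image_subset => Q [].
have {}sub := subset_card_le sub.
(* By Cantor-Bernstein it suffices to close the cycle of inequalities from [nat] through the finite
   [Q] and all [Q] back to [nat]. *)
rewrite !card_eq_le; split; apply/andP; split=> //.
- exact: card_le_trans countable infinite.
- exact: card_le_trans infinite sub.
Qed.
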